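(* Let $(X,\mathcal B,\mu)$ be a $\sigma$-finite measure space with $\mu(X)>0$, let $\mathcal X\subset L^0(\mu)$ be an admissible Banach space of functions defined on $X$, and let $f:X\to X$ be a measurable nonsingular map such that the composition operator $T_f:\varphi\mapsto\varphi\circ f$ is bounded on $\mathcal X$. Then the following assertions are equivalent: (A1) $T_f$ is topologically transitive; (A2) $f^{-1}(\mathcal B)=\mathcal B$ and, for all $\epsilon>0$ and all $A\in\mathcal B$ with finite measure, there exist a measurable set $B\subset A$, an integer $k\ge 1$ and $C\in\mathcal B$ such that $$\mu(A\setminus B)<\epsilon,\quad \mu(f^{-k}(B))<\epsilon,\quad f^k(B)\subset C\quad\text{and}\quad \mu(C)<\epsilon.$$
   Context: $L^0(\mu)$ denotes the space of measurable scalar-valued functions on $X$ (up to $\mu$-a.e. equality). A Banach space of functions $(\mathcal X,\|\cdot\|)\subset L^0(\mu)$ is always assumed to be a lattice: if $\psi_1,\psi_2$ are measurable functions with $|\psi_1|\le|\psi_2|$ and $\psi_2\in\mathcal X$, then $\psi_1\in\mathcal X$ and $\|\psi_1\|\le\|\psi_2\|$. It is called admissible if: (H1) for every $A\in\mathcal B$ with finite measure, the characteristic function $\chi_A$ belongs to $\mathcal X$; (H2) the set of simple functions which vanish outside a set of finite measure is dense in $\mathcal X$; (H3) for all $\epsilon>0$ there exists $\delta>0$ such that, for all $\psi\in\mathcal X$ and all $S\in\mathcal B$, $|\psi|\ge 1$ on $S$ and $\|\psi\|\le\delta$ imply $\mu(S)<\epsilon/2$; (H4) for all $\eta>0$ and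 all $M>0$ there exists $\epsilon>0$ such that, for all $\psi\in\mathcal X$ and all $S\in\mathcal B$, $\mu(S)<\epsilon$, $\psi=0$ on $X\setminus S$ and $|\psi|\le 2M$ imply $\|\psi\|<\eta/2$. A measurable map $f:X\to X$ is nonsingular if $\mu(f^{-1}(S))=0$ whenever $\mu(S)=0$. Here $f^{-1}(\mathcal B)=\{f^{-1}(S):S\in\mathcal B\}$, $f^k$ is the $k$-th iterate of $f$, and $f^{-k}(B)$ is the preimage of $B$ under $f^k$. A bounded linear operator $T$ on a Banach space $\mathcal X$ is topologically transitive if for any nonempty open sets $U,V\subset\mathcal X$ there exists an integer $k\ge0$ such that $T^k(U)\cap V\ne\emptyset$.
   Formalization: In (A2), f^{-1}(B)=B is understood modulo μ-null sets (each measurable set differs from some f^{-1}(S) by a null set); with literal equality (A1)⇒(A2) fails, e.g. when f identifies two points of measure zero. *)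

(* Defs.v *)
From HB Require Import structures.
From mathcomp Require Import all_boot all_order all_algebra complex.
From mathcomp Require Import all_classical all_reals all_analysis.

Set Implicit Arguments.
Unset Strict Implicit.
Unset Printing Implicit Defensive.

Import Order.TTheory GRing.Theory Num.Theory.
Import numFieldNormedType.Exports.

Local Open Scope classical_set_scope.
Local Open Scope ring_scope.

Variant scalar_field (R : realType) : numFieldType -> Prop :=
| RealScalars : scalar_field R R
| ComplexScalars : scalar_field R R[i].

(* Scalar-valued functions are measurable with respect to the Borel
   sigma-algebra of the scalar field, which also covers R[i]. *)
Notation borel K := (g_sigma_algebraType (@open K)).

Definition L0 d (X : measurableType d) (R : realType)
    (mu : {measure set X -> \bar R}) (K : numFieldType) : Type :=
  {mfun_ mu, X >-> borel K}.

Section function_space.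
Context d (X : measurableType d) (R : realType).
Variables (mu : {measure set X -> \bar R}) (K : numFieldType).

(* A measurable representative of an a.e.-class; every use below is insensitive
   to its choice. *)
Definition L0_fun (u : L0 mu K) : X -> K := aqEqMfun_to_fun u.

(* A Banach space of functions is a Banach space with a linear embedding in
   L0, the inclusion of the space in L0. As always in normedModType K, norms
   take their values in K, where a positive element is necessarily real. *)
Record function_space := FunctionSpace {
  carrier :> completeNormedModType K ;
  to_L0 : carrier -> L0 mu K ;
  to_L0_inj : injective to_L0 ;
  to_L0_linear : forall (a : K) (u v : carrier),
    L0_fun (to_L0 (a *: u + v)) =
    (fun t => a * L0_fun (to_L0 u) t + L0_fun (to_L0 v) t) %[ae mu] ;
  to_L0_lattice : forall (w : L0 mu K) (u : carrier),
    {ae mu, forall t, `|L0_fun w t| <= `|L0_fun (to_L0 u) t|} ->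
    exists2 v : carrier, to_L0 v = w & `|v| <= `|u|
}.

Definition fn (E : function_space) (u : E) : X -> K := L0_fun (to_L0 u).

Definition simple_finite_support (s : X -> K) : Prop :=
  [/\ measurable_fun [set: X] (s : X -> borel K), finite_set (range s) &
      exists A : set X,
        [/\ measurable A, (mu A < +oo)%E & forall t, ~ A t -> s t = 0]].

Record admissible (E : function_space) : Prop := Admissible {
  admissible_indic : forall A : set X, measurable A -> (mu A < +oo)%E ->
    exists u : E, fn u = \1_A %[ae mu] ;
  admissible_dense :
    dense [set u : E | exists2 s : X -> K,
                         simple_finite_support s & fn u = s %[ae mu]] ;
  admissible_small_measure : forall eps : R, 0 < eps ->
    exists2 delta : K, 0 < delta &
      forall (u : E) (S : set X), measurable S ->
        {ae mu, forall t, S t -> 1 <= `|fn u t|} -> `|u| <= delta ->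
        (mu S < (eps / 2)%:E)%E ;
  admissible_small_norm : forall eta M : K, 0 < eta -> 0 < M ->
    exists2 eps : R, 0 < eps &
      forall (u : E) (S : set X), measurable S -> (mu S < eps%:E)%E ->
        {ae mu, forall t, ~ S t -> fn u t = 0} ->
        {ae mu, forall t, `|fn u t| <= 2 * M} -> `|u| < eta / 2
}.

Definition nonsingular (f : X -> X) : Prop :=
  forall S : set X, measurable S -> mu S = 0%E -> mu (f @^-1` S) = 0%E.

Definition is_composition_operator (f : X -> X) (E : function_space)
    (T : E -> E) : Prop :=
  forall u : E, fn (T u) = fn u \o f %[ae mu].

(* Equality of two families of sets in the measure algebra of mu. Since T_f acts
   on a.e.-classes, it does not see null sets, and equality of a preimage
   sigma-algebra with the full one can only be asked up to them. *)
Definition eq_mod_null (G H : set (set X)) : Prop :=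
  (forall A, G A -> exists2 B, H B & mu.-negligible (A `+` B)) /\
  (forall B, H B -> exists2 A, G A & mu.-negligible (A `+` B)).

End function_space.

Definition bounded_operator (K : numFieldType) (E : normedModType K)
    (T : E -> E) : Prop :=
  exists M : K, forall u : E, `|T u| <= M * `|u|.

Definition topologically_transitive (E : topologicalType) (T : E -> E) : Prop :=
  forall U V : set E, open U -> open V -> U !=set0 -> V !=set0 ->
  exists k : nat, (iter k T @` U) `&` V !=set0.

(* Main.v *)
(** If [T] is transitive, some [u] is close to [1_A] while [u \o f^k] is close to
    [2 * 1_A]; by (H3) closeness in norm gives closeness in measure.  Then
    [B = {x in A : u x ~ 1 and u (f^k x) ~ 2}] and [C = {u ~ 2}] witness the
    second half of (A2), and [{u \o f^(k-1) ~ 2}] is a set whose preimage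
    under [f] is close to [A]; a limsup of such sets has preimage [A] up to a
    null set (Borel-Cantelli).

    Conversely, let [phi], [psi] be simple functions supported in [A], to be
    sent from near [phi] to near [psi].  Since the preimages under [f^k] exhaust
    the measurable sets modulo null sets, [psi * 1_B = h \o f^k] for some [h].
    The function equal to [h] on [C] and to [phi * 1_B] elsewhere differs from
    [phi] only on [(A \ B) U C], and its composition with [f^k] differs from
    [psi] only on [(A \ B) U f^-k(B)]; by (H4) both differences are small.
    Gluing along measurable sets avoids any sum of measurable functions, so
    nothing is needed about the Borel structure of the scalar field. *)

Require Import Defs.
From HB Require Import structures.
From mathcomp Require Import all_boot all_order all_algebra complex.
From mathcomp Require Import all_classical all_reals all_analysis.

Set Implicit Arguments.
Unset Strict Implicit.
Unset Printing Implicit Defensive.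

Import Order.TTheory GRing.Theory Num.Theory.
Import numFieldNormedType.Exports.

Local Open Scope classical_set_scope.
Local Open Scope ring_scope.

(** * Almost-everywhere properties, iterates and gluing of functions *)

Lemma negligible_setYP d (X : measurableType d) (R : realType)
    (mu : {measure set X -> \bar R}) (A B : set X) :
  mu.-negligible (A `+` B) <-> \forall x \ae mu, A x <-> B x.
Proof.
suff -> : A `+` B = ~` [set x | A x <-> B x] by [].
apply/seteqP; split=> x /=; first by case=> -[? nB] [? ?]; apply: nB; tauto.
by move=> nAB; have [Ax|nAx] := pselect (A x); have [Bx|nBx] := pselect (B x);
  [case: nAB|left|right|case: nAB].
Qed.

(** The exceptional null set pulls back along [f] to a null set; this is how nonsingularity enters
    everywhere below. *)
Lemma ae_comp d (X : measurableType d) (R : realType)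
    (mu : {measure set X -> \bar R}) (f : X -> X) (P : X -> Prop) :
  measurable_fun [set: X] f -> nonsingular mu f ->
  (\forall x \ae mu, P x) -> \forall x \ae mu, P (f x).
Proof.
move=> mf nf [N [mN N0 PN]]; exists (f @^-1` N); split.
- by rewrite -[_ @^-1` _]setTI; exact: mf.
- exact: nf.
- by move=> x nP; exact: PN.
Qed.

Lemma measurable_fun_iter d (X : measurableType d) (f : X -> X) k :
  measurable_fun [set: X] f -> measurable_fun [set: X] (iter k f).
Proof.
move=> mf; elim: k => [|k IHk]; first exact: measurable_id.
by rewrite (_ : iter k.+1 f = f \o iter k f)//; exact: measurableT_comp.
Qed.

Lemma nonsingular_iter d (X : measurableType d) (R : realType)
    (mu : {measure set X -> \bar R}) (f : X -> X) k :
  measurable_fun [set: X] f -> nonsingular mu f -> nonsingular mu (iter k f).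
Proof.
move=> mf nf; elim: k => [//|k IHk] S mS S0.
rewrite (_ : iter k.+1 f @^-1` S = iter k f @^-1` (f @^-1` S))//.
by apply: IHk; [rewrite -[_ @^-1` _]setTI; exact: mf|exact: nf].
Qed.

Lemma measurable_fun_if_mem d1 d2 (X : measurableType d1) (Y : measurableType d2)
    (A : set X) (g h : X -> Y) :
  measurable A -> measurable_fun [set: X] g -> measurable_fun [set: X] h ->
  measurable_fun [set: X] (fun x => if x \in A then g x else h x).
Proof.
move=> mA mg mh; apply: measurable_fun_ifT => //.
apply: (measurable_fun_bool true); rewrite setTI.
by rewrite (_ : _ @^-1` _ = A)//; apply/seteqP; split=> x; [exact: set_mem|exact: mem_set].
Qed.

(** * Borel sets of the scalar field *)

Section borel_sets.
Variable K : numFieldType.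

Lemma borel_open (U : set K) : open U -> measurable (U : set (borel K)).
Proof. exact: sub_sigma_algebra. Qed.

Lemma borel_set1 (a : K) : measurable ([set a] : set (borel K)).
Proof.
rewrite -[[set a]]setCK; apply: measurableC; apply: borel_open.
rewrite openC.
exact: accessible_closed_set1 (hausdorff_accessible (@norm_hausdorff K K^o)) _.
Qed.

Lemma borel_norm_lt (c r : K) :
  measurable ([set z | `|z - c| < r] : set (borel K)).
Proof.
have -> : [set z | `|z - c| < r] = ball c r.
  by rewrite -ball_normE; apply/seteqP; split=> z /=; rewrite distrC.
by apply: borel_open; exact: (@ball_open K K^o).
Qed.

(** When |z| exceeds [r], the ball of radius |z| - r around [z] avoids the set. Realness of [r]
    makes it comparable with |z| in the partial order of [K]. *)
Lemma borel_norm_le (r : K) : r \is Num.real ->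
  measurable ([set z | `|z| <= r] : set (borel K)).
Proof.
move=> rr; rewrite -[X in measurable X]setCK; apply: measurableC.
apply: borel_open; rewrite openE => z /= nz; apply/nbhs_ballP.
have rz : r < `|z| by rewrite real_ltNge ?normr_real//; exact/negP.
exists (`|z| - r); rewrite /= ?subr_gt0// => w.
rewrite -ball_normE /= => zw wr.
have := le_lt_trans (lerB_dist z w) zw.
by rewrite ltrD2l ltrN2 => /lt_le_trans/(_ wr); rewrite ltxx.
Qed.

End borel_sets.

(** * Vectors of the function space and their representatives *)

Section function_space.
Context d (X : measurableType d) (R : realType).
Variables (mu : {measure set X -> \bar R}) (K : numFieldType).
Variable E : function_space mu K.

Lemma measurable_fn (u : E) :
  measurable_fun [set: X] (fn u : X -> borel K).
Proof. exact: (@measurable_funPT _ _ _ _ (repr (to_L0 u))). Qed.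

Lemma fn_lin (a b : K) (u v : E) : \forall x \ae mu,
  fn (a *: u + b *: v) x = a * fn u x + b * fn v x.
Proof.
have := to_L0_linear (1 : K) (0 : E) 0; have := to_L0_linear b v 0.
have := to_L0_linear a u (b *: v).
rewrite scaler0 !addr0; apply: filterS3 => x /(_ Logic.I) auv.
move=> /(_ Logic.I) bv /(_ Logic.I).
rewrite mul1r -[LHS]addr0 => /addrI u0.
by rewrite /fn auv bv -u0 addr0.
Qed.

Lemma exists_L0 (g : X -> K) : measurable_fun [set: X] (g : X -> borel K) ->
  exists w : L0 mu K, L0_fun w = g %[ae mu].
Proof.
move=> mg; pose g' : {mfun X >-> borel K} := mfun_Sub (mem_set mg).
exists (\pi_({mfun_ mu, X >-> borel K})%qT g').
have /asboolP : ae_eq_op mu (repr (\pi_({mfun_ mu, X >-> borel K})%qT g')) g'.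
  by rewrite -eqmodE reprK.
by [].
Qed.

Hypothesis E_adm : admissible E.

(** By (H1) the space contains [M] times the indicator of [A], which dominates [g]; the lattice
    property then applies. *)
Lemma exists_fn (A : set X) (M : K) (g : X -> K) :
  measurable A -> (mu A < +oo)%E -> measurable_fun [set: X] (g : X -> borel K) ->
  (forall x, `|g x| <= M) -> (forall x, ~ A x -> g x = 0) ->
  exists u : E, fn u = g %[ae mu].
Proof.
move=> mA Aoo mg gM g0; have [w wA] := admissible_indic E_adm mA Aoo.
have [g' gg'] := exists_L0 mg.
have [|v vg' _] := @to_L0_lattice _ _ _ _ _ E g' (M *: w + 0 *: w).
  apply: filterS3 (fn_lin M 0 w w) gg' wA => x.
  rewrite -/(fn _) => -> /(_ Logic.I) -> /(_ Logic.I) ->.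
  rewrite mul0r addr0 indicE; have [Ax|Ax] := boolP (x \in A).
    by rewrite mulr1 (le_trans (gM x))// ger0_norm // (le_trans _ (gM x)).
  by rewrite g0 ?normr0// => /mem_set; apply/negP.
by exists v; rewrite /fn vg'.
Qed.

End function_space.

(** Triangle inequality. It serves to separate the values 0, 1 and 2 from one another. *)
Lemma half_le_dist (K : numFieldType) (a b z : K) :
  1 <= `|a - b| -> `|z - a| < 2^-1 -> 2^-1 <= `|z - b|.
Proof.
move=> ab za; have := le_trans ab (ler_distD z a b).
rewrite (distrC a z) => /le_lt_trans/(_ (ltr_leD za (lexx `|z - b|))).
by rewrite -ltrBlDl [X in X - _](splitr 1) !div1r addrK => /ltW.
Qed.

(** * From approximate preimages to an exact one modulo null sets *)

Section approximate_preimage.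
Context d (X : measurableType d) (R : realType).
Variables (mu : {measure set X -> \bar R}) (f : X -> X).
Hypothesis f_meas : measurable_fun [set: X] f.

Lemma measurable_setY (A B : set X) :
  measurable A -> measurable B -> measurable (A `+` B).
Proof. by move=> mA mB; apply: measurableU; exact: measurableD. Qed.

Lemma preimage_of_approx (A : set X) : measurable A ->
  (forall eps : R, 0 < eps -> exists2 S : set X,
    measurable S & (mu ((f @^-1` S) `+` A) < eps%:E)%E) ->
  exists2 S : set X, measurable S & \forall x \ae mu, S (f x) <-> A x.
Proof.
move=> mA approx.
have /choice[S hS] n : exists S : set X, measurable S /\
    (mu ((f @^-1` S) `+` A) <= (1 / (2 ^ n.+1)%:R : R)%:E)%E.
  have [|S mS /ltW ?] := approx (1 / (2 ^ n.+1)%:R); last by exists S.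
  by rewrite divr_gt0// ltr0n expn_gt0.
have mS n : measurable (S n) by have [] := hS n.
have mfS n : measurable (f @^-1` S n) by rewrite -[_ @^-1` _]setTI; exact: f_meas.
pose F n := (f @^-1` S n) `+` A.
exists (lim_sup_set S).
  by apply: bigcapT_measurable => n; exact: bigcup_measurable.
have mF n : measurable (F n) by exact: measurable_setY.
(* Borel-Cantelli: the errors [F n] have total measure at most 1, so almost every point lies in only
   finitely many of them. *)
have F0 : mu (lim_sup_set F) = 0%E.
  apply: lim_sup_set_cvg0 => //; apply: (@le_lt_trans _ _ 1%:E); last exact: ltry.
  apply: le_trans (epsilon_trick0 xpredT ler01).
  by apply: lee_nneseries => // n _; have [] := hS n.
exists (lim_sup_set F); split => //.
  by apply: bigcapT_measurable => n; exact: bigcup_measurable.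
move=> x /= SA; apply: contrapT => nF; apply: SA.
have [n hn] : exists n, forall m, (n <= m)%N -> ~ F m x.
  apply: contrapT => h; apply: nF => n _; apply: contrapT => hF; apply: h.
  by exists n => m nm Fm; apply: hF; exists m.
have SA m : (n <= m)%N -> S m (f x) <-> A x.
  by move=> /hn nFm; split=> [Sm|Ax]; apply: contrapT => h; apply: nFm;
    [left|right].
split=> [/(_ n Logic.I)[m /= nm] /SA-/(_ nm)//|Ax m _].
by exists (maxn n m); rewrite /= ?leq_maxr//; apply/SA; rewrite ?leq_maxl.
Qed.

End approximate_preimage.

(** * Transitivity implies (A2) *)

Section transitive.
Context d (X : measurableType d) (R : realType).
Variables (mu : {measure set X -> \bar R}) (K : numFieldType).

(** The threshold is half the gap between consecutive values among 0, 1, 2; doubling it gives the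
    threshold 1 of (H3). *)
Definition deviation (A : set X) (c : K) (phi : X -> K) : set X :=
  [set x | 2^-1 <= `|phi x - c * \1_A x|].

Lemma notin_deviation (A : set X) (c : K) (phi : X -> K) (x : X) :
  ~ deviation A c phi x -> `|phi x - c * \1_A x| < 2^-1.
Proof. by move=> h; rewrite real_ltNge ?normr_real ?rpredV ?realn//; exact/negP. Qed.

(** The indicator is constant on [A] and off [A], so the complement splits into preimages of balls
    around [c] and 0, without subtracting measurable functions. *)
Lemma measurable_deviation (A : set X) (c : K) (phi : X -> K) :
  measurable A -> measurable_fun [set: X] (phi : X -> borel K) ->
  measurable (deviation A c phi).
Proof.
move=> mA mphi; rewrite -[deviation _ _ _]setCK; apply: measurableC.
have mB r : measurable (phi @^-1` [set z | `|z - r| < 2^-1]).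
  by rewrite -[_ @^-1` _]setTI; apply: mphi => //; exact: borel_norm_lt.
suff -> : ~` deviation A c phi =
    (A `&` phi @^-1` [set z | `|z - c| < 2^-1]) `|`
    (~` A `&` phi @^-1` [set z | `|z - 0| < 2^-1]).
  by apply: measurableU; apply: measurableI => //; exact: measurableC.
apply/seteqP; split=> x.
  move=> /notin_deviation; rewrite indicE.
  have [/set_mem Ax|/negP nA] := boolP (x \in A); rewrite ?mulr1 ?mulr0.
    by left.
  by right; split => // Ax; apply: nA; exact: mem_set.
rewrite /deviation/= indicE => -[|] [Ax] h.
  by apply/negP; rewrite -real_ltNge ?mem_set ?mulr1 ?normr_real ?rpredV ?realn.
by apply/negP; rewrite -real_ltNge ?memNset ?mulr0 ?normr_real ?rpredV ?realn.
Qed.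

Variable E : function_space mu K.
Hypothesis E_adm : admissible E.

(** For [u] within [delta / 2] of [c *: w], (H3) applies to twice the difference. Any measurable
    representative [phi] is allowed, so that [fn u \o iter k f] can stand for [iter k T u]. *)
Lemma deviation_small (A : set X) (c : K) (eps : R) :
  measurable A -> (mu A < +oo)%E -> 0 < eps ->
  exists U : set E, [/\ open U, U !=set0 &
    forall (u : E) (phi : X -> K), U u ->
      measurable_fun [set: X] (phi : X -> borel K) ->
      fn u = phi %[ae mu] -> (mu (deviation A c phi) < eps%:E)%E].
Proof.
move=> mA Aoo eps0; have [w wA] := admissible_indic E_adm mA Aoo.
have [delta delta0 small] := admissible_small_measure E_adm eps0.
exists (ball (c *: w) (delta / 2)); split; first exact: ball_open.
  by exists (c *: w); apply: ballxx; rewrite divr_gt0.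
move=> u phi; rewrite -ball_normE /= => wu mphi uphi.
apply: (@lt_trans _ _ (eps / 2)%:E); last first.
  by rewrite lte_fin ltr_pdivrMr// ltr_pMr// ltr1n.
apply: (small (2 *: (u + - c *: w))); first exact: measurable_deviation.
- have := fn_lin 2 0 (1 *: u + - c *: w) 0; have := fn_lin 1 (- c) u w.
  rewrite !scale1r scale0r addr0; apply: filterS3 (filterI uphi wA) => x.
  move=> [/(_ Logic.I) ux /(_ Logic.I) wx] uwx ->; rewrite uwx ux wx.
  rewrite /deviation/= mul0r addr0 mul1r mulNr normrM normr_nat => h.
  by rewrite -ler_pdivrMl// mulr1.
- by rewrite scaleNr normrZ normr_nat distrC -ler_pdivlMl// mulrC ltW.
Qed.

Variables (f : X -> X) (T : E -> E).
Hypothesis f_meas : measurable_fun [set: X] f.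
Hypothesis f_nonsing : nonsingular mu f.
Hypothesis T_comp : is_composition_operator f T.

Lemma fn_iter (k : nat) (u : E) :
  fn (iter k T u) = fn u \o iter k f %[ae mu].
Proof.
elim: k => [|k IHk]; first exact: aeW.
apply: filterS2 (T_comp (iter k T u)) (ae_comp f_meas f_nonsing IHk) => x.
by move=> /(_ Logic.I) Tx /(_ Logic.I) ux _; rewrite Tx /= ux /= -iterSr.
Qed.

Hypothesis T_trans : topologically_transitive T.

(* No vector is close to both [1_A] and [2 * 1_A] unless [A] is small, which is
   how the exponent [k = 0] is excluded. *)
Lemma transitive_deviation (A : set X) (eps : R) :
  measurable A -> (mu A < +oo)%E -> 0 < eps ->
  exists (k : nat) (phi : X -> K),
    [/\ measurable_fun [set: X] (phi : X -> borel K),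
        (mu (deviation A 1 phi) < eps%:E)%E,
        (mu (deviation A 2 (phi \o iter k f)) < eps%:E)%E &
        k = 0%N -> (mu A < eps%:E)%E].
Proof.
move=> mA Aoo eps0.
(* Half of [eps], because for [k = 0] two deviation sets together cover [A]. *)
have e20 : 0 < eps / 2 by rewrite divr_gt0.
have e2 : ((eps / 2)%:E < eps%:E)%E.
  by rewrite lte_fin ltr_pdivrMr// ltr_pMr// ltr1n.
have [U [oU U0 hU]] := deviation_small 1 mA Aoo e20.
have [V [oV V0 hV]] := deviation_small 2 mA Aoo e20.
have [k [_ [[u Uu <-] Vu]]] := T_trans oU oV U0 V0.
have mu1 : measurable_fun [set: X] (fn u : X -> borel K) by exact: measurable_fn.
have mu2 : measurable_fun [set: X] (fn u \o iter k f : X -> borel K).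
  by apply: measurableT_comp => //; exact: measurable_fun_iter.
have dev1 := hU _ _ Uu mu1 (aeW _ (fun=> fun=> erefl)).
have dev2 := hV _ _ Vu mu2 (fn_iter k u).
exists k, (fn u); split => //; [exact: lt_trans e2|exact: lt_trans e2|].
move=> k0; rewrite k0 in mu2 dev2; rewrite [eps]splitr EFinD.
apply: le_lt_trans (lteD dev1 dev2).
apply: le_trans (measureU2 _ _ _); try exact: measurable_deviation.
apply: le_measure; rewrite ?inE//.
  by apply: measurableU; exact: measurable_deviation.
move=> x Ax; apply: contrapT => /not_orP[/notin_deviation d1 d2]; apply: d2.
rewrite /deviation/= indicE mem_set// mulr1.
apply: half_le_dist (d1); rewrite indicE mem_set// mulr1 distrC.
by rewrite -[2]/(1 + 1) addrK normr1.
Qed.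

Lemma transitive_approx_preimage (A : set X) (eps : R) :
  measurable A -> (mu A < +oo)%E -> 0 < eps ->
  exists2 S : set X, measurable S & (mu ((f @^-1` S) `+` A) < eps%:E)%E.
Proof.
move=> mA Aoo eps0.
have [[|k] [phi [mphi dev1 dev2 k0]]] := transitive_deviation mA Aoo eps0.
  (* For exponent 0 the set [A] is itself small, so the empty set approximates it. *)
  by exists set0; rewrite // preimage_set0 setYC setY0; exact: k0.
have mphik : measurable_fun [set: X] (phi \o iter k f : X -> borel K).
  by apply: measurableT_comp => //; exact: measurable_fun_iter.
have mphik1 : measurable_fun [set: X] (phi \o iter k.+1 f : X -> borel K).
  by apply: measurableT_comp => //; exact: measurable_fun_iter.
pose S := (phi \o iter k f) @^-1` [set z | `|z - 2| < 2^-1].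
have mS : measurable S.
  by rewrite -[S]setTI; apply: mphik => //; exact: borel_norm_lt.
exists S => //; apply: le_lt_trans dev2; apply: le_measure; rewrite ?inE.
- by apply: measurable_setY => //; rewrite -[_ @^-1` _]setTI; exact: f_meas.
- exact: measurable_deviation.
(* A value near 2 off [A] is far from 0, and a value not near 2 on [A] is a deviation by
   definition. *)
- move=> x [[Sx nA]|[Ax nS]]; rewrite /deviation/= indicE.
    rewrite memNset// mulr0; apply: (@half_le_dist _ 2).
      by rewrite subr0 normr_nat ler1n.
    by move: Sx; rewrite /S/= -iterSr.
  rewrite mem_set// mulr1; apply: contrapT => h; apply: nS.
  rewrite /S/= -iterSr real_ltNge ?normr_real ?rpredV ?realn//.
  exact/negP.
Qed.

Lemma transitive_preimage :
  sigma_finite [set: X] mu ->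
  eq_mod_null mu (preimage_set_system [set: X] f measurable) measurable.
Proof.
move=> [F FT Ffin]; split=> [_ [B mB <-]|B mB].
  exists ([set: X] `&` f @^-1` B); first exact: f_meas.
  by apply/negligible_setYP; exact: aeW.
(* Approximation requires finite measure, so [B] is cut along the exhaustion [F]; preimages commute
   with the union that reassembles it. *)
have /choice[S hS] n : exists S : set X, measurable S /\
    \forall x \ae mu, S (f x) <-> (B `&` F n) x.
  have [mF Foo] := Ffin n; have mBF := measurableI _ _ mB mF.
  have [|S mS hS] := preimage_of_approx (mu := mu) f_meas mBF; last by exists S.
  move=> eps eps0; apply: transitive_approx_preimage => //.
  by apply: le_lt_trans Foo; apply: le_measure; rewrite ?inE.
exists ([set: X] `&` f @^-1` \bigcup_n S n).
  by exists (\bigcup_n S n) => //; apply: bigcup_measurable => n _; case: (hS n).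
apply/negligible_setYP; have := ae_foralln (fun n => proj2 (hS n)).
apply: filterS => x Sx; split=> [[_ [n _ /Sx[]//]]|Bx]; split => //.
have [n _ Fx] : (\bigcup_n F n) x by rewrite -FT.
by exists n => //; apply/Sx.
Qed.

Lemma transitive_small_iterates (eps : R) (A : set X) :
  0 < eps -> measurable A -> (mu A < +oo)%E ->
  exists (B : set X) (k : nat) (C : set X),
    [/\ measurable B, B `<=` A, (1 <= k)%N & measurable C] /\
    [/\ (mu (A `\` B) < eps%:E)%E,
        (mu (iter k f @^-1` B) < eps%:E)%E,
        iter k f @` B `<=` C &
        (mu C < eps%:E)%E].
Proof.
move=> eps0 mA Aoo; have e20 : 0 < eps / 2 by rewrite divr_gt0.
have e2 : ((eps / 2)%:E < eps%:E)%E.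
  by rewrite lte_fin ltr_pdivrMr// ltr_pMr// ltr1n.
have [k [phi [mphi dev1 dev2 k0]]] := transitive_deviation mA Aoo e20.
have [kE|] := posnP k.
  (* Here [A] is already small, so [B] may be empty and any positive exponent works. *)
  exists set0, 1%N, set0; split; first by split.
  rewrite setD0 preimage_set0 image_set0 measure0 lte_fin; split=> //.
  by apply: lt_trans e2; exact: k0.
move=> k_gt0.
have mphik : measurable_fun [set: X] (phi \o iter k f : X -> borel K).
  by apply: measurableT_comp => //; exact: measurable_fun_iter.
pose D1 := deviation A 1 phi; pose D2 := deviation A 2 (phi \o iter k f).
have mD1 : measurable D1 by exact: measurable_deviation.
have mD2 : measurable D2 by exact: measurable_deviation.
pose B := A `\` (D1 `|` D2); pose C := phi @^-1` [set z | `|z - 2| < 2^-1].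
have mB : measurable B by apply: measurableD => //; exact: measurableU.
have mC : measurable C.
  by rewrite -[C]setTI; apply: mphi => //; exact: borel_norm_lt.
exists B, k, C; split; first by split => // x [].
split.
- rewrite [eps]splitr EFinD; apply: le_lt_trans (lteD dev1 dev2).
  apply: le_trans (measureU2 _ mD1 mD2).
  apply: le_measure; rewrite ?inE; [exact: measurableD|exact: measurableU|].
  by move=> x [Ax nB]; apply: contrapT => nD; apply: nB.
- apply: lt_trans e2; apply: le_lt_trans dev2; apply: le_measure; rewrite ?inE//.
    by rewrite -[_ @^-1` _]setTI; exact: measurable_fun_iter.
  (* If [iter k f x] is in [B], then [phi] is near 1 there, hence far from both values 0 and 2 of
     [2 * \1_A]: [x] is in [D2]. *)
  move=> x [Ax /not_orP[/notin_deviation d1 _]]; rewrite /deviation/=.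
  apply: half_le_dist d1; rewrite !indicE mem_set// mul1r.
  case: (x \in A); last by rewrite mulr0 subr0 normr1.
  by rewrite mulr1 distrC -[2]/(1 + 1) addrK normr1.
- move=> _ [x [Ax /not_orP[_ /notin_deviation d2]] <-].
  by move: d2; rewrite indicE mem_set// mulr1.
- apply: lt_trans e2; apply: le_lt_trans dev1; apply: le_measure; rewrite ?inE//.
  (* On [C] the value of [phi] is near 2, hence far from both values 0 and 1 of the indicator. *)
  move=> x Cx; rewrite /deviation/=; apply: half_le_dist Cx.
  rewrite indicE; case: (x \in A); last by rewrite mulr0 subr0 normr_nat ler1n.
  by rewrite mulr1 -[2]/(1 + 1) addrK normr1.
Qed.

End transitive.

(** * (A2) implies transitivity *)

Section approximation_transitive.
Context d (X : measurableType d) (R : realType).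
Variables (mu : {measure set X -> \bar R}) (K : numFieldType).
Variables (f : X -> X).
Hypothesis f_meas : measurable_fun [set: X] f.
Hypothesis f_nonsing : nonsingular mu f.
Hypothesis f_preimage :
  eq_mod_null mu (preimage_set_system [set: X] f measurable) measurable.

Lemma preimage_iter (k : nat) (B : set X) : measurable B ->
  exists2 S : set X, measurable S & \forall x \ae mu, S (iter k f x) <-> B x.
Proof.
elim: k B => [|k IHk] B mB; first by exists B => //; exact: aeW.
have [_ [S1 mS1 <-] /negligible_setYP SB] := f_preimage.2 B mB.
have [S mS SS1] := IHk S1 mS1; exists S => //.
apply: filterS2 SB (ae_comp f_meas f_nonsing SS1) => x.
by rewrite -iterSr setTI => <-.
Qed.

(** Each level set of [g] is a preimage under [iter k f] modulo a null set. Induction on the list of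
    values builds [h], overwriting it by [a] on the set [S] that pulls back to the level set of
    [a]. *)
Lemma factor_iter (k : nat) (g : X -> K) :
  measurable_fun [set: X] (g : X -> borel K) -> finite_set (range g) ->
  exists2 h : X -> K, measurable_fun [set: X] (h : X -> borel K) &
    h \o iter k f = g %[ae mu].
Proof.
move=> mg /finite_seqP[s gs].
suff [h mh hg] : exists2 h : X -> K, measurable_fun [set: X] (h : X -> borel K) &
    \forall x \ae mu, g x \in s -> h (iter k f x) = g x.
  exists h => //; apply: filterS hg => x hg _; apply: hg.
  suff : [set` s] (g x) by [].
  by rewrite -gs; exists x.
elim: s {gs} => [|a s [h mh hg]]; first by exists (cst 0) => //; exact: aeW.
have mga : measurable (g @^-1` [set a]).
  by rewrite -[_ @^-1` _]setTI; apply: mg => //; exact: borel_set1.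
have [S mS Sg] := preimage_iter k mga.
exists (fun x => if x \in S then a else h x).
  by apply: (@measurable_fun_if_mem _ _ X (borel K)).
apply: filterS2 Sg hg => x Sg hg; rewrite inE => gas.
have [Sx|nSx] := boolP (iter k f x \in S); first exact/esym/Sg/set_mem.
apply: hg; case/predU1P: gas => // /Sg Sx.
by rewrite mem_set in nSx.
Qed.

Variables (E : function_space mu K) (T : E -> E).
Hypothesis E_adm : admissible E.
Hypothesis T_comp : is_composition_operator f T.

Lemma simple_bounded (s : X -> K) : simple_finite_support mu s ->
  exists2 M : K, 0 < M & forall x, `|s x| <= M.
Proof.
(* Summing the absolute values avoids comparing them; the 1 ensures positivity. *)
move=> [_ /finite_seqP[r sr] _]; exists (1 + \sum_(a <- r) `|a|).
  by rewrite ltr_pwDl// sumr_ge0.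
move=> x; have xr : s x \in r.
  suff : [set` r] (s x) by [].
  by rewrite -sr; exists x.
by rewrite (big_rem _ xr)/= addrCA lerDl addr_ge0// sumr_ge0//.
Qed.

(** (H2) provides [s] in [U], and (H4) bounds the effect of changing it on a small set. As [s]
    precedes [M], one [M] can later bound two simple functions. *)
Lemma near_simple (U : set E) : open U -> U !=set0 ->
  exists s : X -> K, simple_finite_support mu s /\
  forall M : K, 0 < M -> exists2 eps : R, 0 < eps &
    forall (u : E) (g : X -> K) (S : set X), fn u = g %[ae mu] ->
      measurable S -> (mu S < eps%:E)%E ->
      (\forall x \ae mu, ~ S x -> g x = s x) ->
      (\forall x \ae mu, `|g x - s x| <= 2 * M) -> U u.
Proof.
move=> oU U0; have [p [Up [s ss ps]]] := admissible_dense E_adm U0 oU.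
exists s; split => // M M0.
have [eta /= eta0 pU] : nbhs_ball p U.
  by apply/nbhs_ballP; exact: open_nbhs_nbhs.
have [eps eps0 small] := admissible_small_norm E_adm eta0 M0.
exists eps => // u g S ug mS Seps gs gM; apply: pU.
have up : \forall x \ae mu, fn (1 *: u + (-1) *: p) x = g x - s x.
  apply: filterS3 (fn_lin 1 (-1) u p) ug ps => x -> /(_ Logic.I) -> /(_ Logic.I) ->.
  by rewrite mul1r mulN1r.
rewrite -ball_normE /= distrC -[u]scale1r -scaleN1r.
apply: (@lt_trans _ _ (eta / 2)); last by rewrite ltr_pdivrMr// ltr_pMr// ltr1n.
apply: small mS Seps _ _.
  by apply: filterS2 up gs => x -> gs /gs ->; rewrite subrr.
by apply: filterS2 up gM => x ->.
Qed.

Lemma transitive_of_approximation :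
  (forall (eps : R) (A : set X), 0 < eps -> measurable A -> (mu A < +oo)%E ->
     exists (B : set X) (k : nat) (C : set X),
       [/\ measurable B, B `<=` A, (1 <= k)%N & measurable C] /\
       [/\ (mu (A `\` B) < eps%:E)%E,
           (mu (iter k f @^-1` B) < eps%:E)%E,
           iter k f @` B `<=` C &
           (mu C < eps%:E)%E]) ->
  topologically_transitive T.
Proof.
move=> approx U V oU oV U0 V0.
have [phi [sphi hU]] := near_simple oU U0.
have [psi [spsi hV]] := near_simple oV V0.
have [M1 M10 phiM] := simple_bounded sphi.
have [M2 M20 psiM] := simple_bounded spsi.
pose M := M1 + M2; have M0 : 0 < M by rewrite addr_gt0.
have {}phiM x : `|phi x| <= M by rewrite (le_trans (phiM x))// lerDl ltW.
have {}psiM x : `|psi x| <= M by rewrite (le_trans (psiM x))// lerDr ltW.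
have [eU eU0 {}hU] := hU M M0; have [eV eV0 {}hV] := hV M M0.
have [mphi _ [A1 [mA1 A1oo phi0]]] := sphi.
have [mpsi rpsi [A2 [mA2 A2oo psi0]]] := spsi.
pose A := A1 `|` A2; have mA : measurable A by exact: measurableU.
have Aoo : (mu A < +oo)%E.
  by apply: le_lt_trans (measureU2 _ mA1 mA2) _; exact: lte_add_pinfty.
have {}phi0 x : ~ A x -> phi x = 0 by move=> nA; apply: phi0 => ?; apply: nA; left.
have {}psi0 x : ~ A x -> psi x = 0 by move=> nA; apply: psi0 => ?; apply: nA; right.
(* Each exceptional set below is a union of two sets of measure less than [eps]. *)
pose eps := Num.min eU eV / 2.
have eps0 : 0 < eps by rewrite divr_gt0// lt_min eU0.
have [B [k [C [[mB BA _ mC] [AB fB BC muC]]]]] := approx eps A eps0 mA Aoo.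
have small (S1 S2 : set X) : measurable S1 -> measurable S2 ->
    (mu S1 < eps%:E)%E -> (mu S2 < eps%:E)%E ->
    (mu (S1 `|` S2) < eU%:E)%E /\ (mu (S1 `|` S2) < eV%:E)%E.
  move=> mS1 mS2 S1e S2e.
  have : (mu (S1 `|` S2) < (Num.min eU eV)%:E)%E.
    rewrite [Num.min _ _]splitr EFinD.
    exact: le_lt_trans (measureU2 _ mS1 mS2) (lteD S1e S2e).
  by move=> Se; split; apply: lt_le_trans Se _; rewrite lee_fin ge_min lexx ?orbT.
have mAB : measurable (A `\` B) by exact: measurableD.
have mfk : measurable_fun [set: X] (iter k f) by exact: measurable_fun_iter.
have mfB : measurable (iter k f @^-1` B) by rewrite -[_ @^-1` _]setTI; exact: mfk.
have [h mh hpsi] : exists2 h : X -> K, measurable_fun [set: X] (h : X -> borel K) &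
    h \o iter k f = (fun x => if x \in B then psi x else 0) %[ae mu].
  apply: factor_iter.
    exact: (@measurable_fun_if_mem _ _ X (borel K)).
  apply: (@sub_finite_set _ _ (range psi `|` [set 0])); last first.
    by rewrite finite_setU; split.
  by move=> _ [x _ <-]; case: ifP => _; [left; exists x|right].
(* Only the composition of [h] with [iter k f] is controlled, and only a.e.; cutting at |h| <= M
   makes [g] bounded everywhere. *)
pose D := C `&` h @^-1` [set z | `|z| <= M].
have mD : measurable D.
  apply: measurableI => //; rewrite -[_ @^-1` _]setTI; apply: mh => //.
  by apply: borel_norm_le; exact: gtr0_real.
pose g x := if x \in D then h x else if x \in B then phi x else 0.
have gM x : `|g x| <= M.
  rewrite /g; case: ifPn => [/set_mem[]//|_].
  by case: ifP => _; [exact: phiM|rewrite normr0 ltW].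
have mg : measurable_fun [set: X] (g : X -> borel K).
  apply: (@measurable_fun_if_mem _ _ X (borel K)) => //.
  exact: (@measurable_fun_if_mem _ _ X (borel K)).
have [u ug] : exists u : E, fn u = g %[ae mu].
  apply: (@exists_fn _ _ _ _ _ _ E_adm (A `|` C) M) => //.
  - exact: measurableU.
  - apply: le_lt_trans (measureU2 _ mA mC) _; apply: lte_add_pinfty => //.
    exact: lt_trans muC (ltry _).
  - move=> x nAC; rewrite /g memNset; last by case=> Cx _; apply: nAC; right.
    by rewrite memNset// => /BA Ax; apply: nAC; left.
have gap (a b : K) : `|a| <= M -> `|b| <= M -> `|a - b| <= 2 * M.
  by move=> aM bM; rewrite mulr_natl mulr2n (le_trans (ler_normB _ _))// lerD.
exists k, (iter k T u); split.
- exists u => //; apply: (hU u g ((A `\` B) `|` C)) => //.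
  + exact: measurableU.
  + by have [] := small _ _ mAB mC AB muC.
  (* Outside the exceptional set, [x] is in [B], where [g] is [phi], or outside [A], where both
     vanish. *)
  + apply: aeW => x /not_orP[nAB nC]; rewrite /g memNset; last by case.
    have [Bx|/negP nB] := boolP (x \in B) => //.
    rewrite phi0// => Ax; apply: nAB; split => // Bx; apply: nB; exact: mem_set.
  + apply: aeW => x; exact: gap (gM x) (phiM x).
- apply: (hV _ (g \o iter k f) ((A `\` B) `|` iter k f @^-1` B)).
  + have Tu := fn_iter f_meas f_nonsing T_comp k u.
    have fu := ae_comp mfk (nonsingular_iter k f_meas f_nonsing) ug.
    apply: filterS2 Tu fu => x.
    by move=> /(_ Logic.I) Tu /(_ Logic.I) fu _; rewrite Tu /= fu.
  + exact: measurableU.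
  + by have [] := small _ _ mAB mfB AB fB.
  (* Since [iter k f x] is not in [B], [g] there is [h] or 0. For [x] in [B] the point lies in [D],
     as [h] takes there the value [psi x], bounded by [M]; otherwise [psi x] and [h] at that point
     are both 0. *)
  + apply: filterS hpsi => x /(_ Logic.I)/= hx /not_orP[nAB nfB].
    have psi0' : ~ B x -> psi x = 0.
      by move=> nB; apply: psi0 => Ax; apply: nAB.
    rewrite /g (memNset nfB); have [/set_mem Bx|/negP nB] := boolP (x \in B).
      rewrite mem_set in hx => //; rewrite mem_set//; split.
        by apply: BC; exists x.
      by rewrite /= hx.
    have {}nB : ~ B x by move=> /mem_set.
    by rewrite memNset// in hx; rewrite hx psi0' //; case: ifP.
  + apply: aeW => x; exact: gap (gM _) (psiM x).
Qed.

End approximation_transitive.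

Theorem theorem1p1 (d : measure_display) (X : measurableType d) (R : realType)
    (mu : {sigma_finite_measure set X -> \bar R}) (mu_gt0 : (0 < mu [set: X])%E)
    (K : numFieldType) (K_scalar : scalar_field R K)
    (E : function_space mu K) (E_adm : admissible E)
    (f : X -> X) (f_meas : measurable_fun [set: X] f)
    (f_nonsing : nonsingular mu f)
    (T : E -> E) (T_comp : is_composition_operator f T)
    (T_bounded : bounded_operator T) :
  topologically_transitive T <->
  eq_mod_null mu (preimage_set_system [set: X] f measurable) measurable /\
  (forall (eps : R) (A : set X), 0 < eps -> measurable A -> (mu A < +oo)%E ->
     exists (B : set X) (k : nat) (C : set X),
       [/\ measurable B, B `<=` A, (1 <= k)%N & measurable C] /\
       [/\ (mu (A `\` B) < eps%:E)%E,
           (mu (iter k f @^-1` B) < eps%:E)%E,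
           iter k f @` B `<=` C &
           (mu C < eps%:E)%E]).
Proof.
split=> [T_trans|[f_preimage approx]].
  split; first exact: transitive_preimage T_trans (sigma_finiteT mu).
  by move=> eps A; exact: transitive_small_iterates T_trans eps A.
exact: transitive_of_approximation T_comp approx.
Qed.
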